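(* Let $D$ be a link diagram containing a left-twisted kink with crossing $a$, and let $\rho_1:\mathcal C(D)=\mathcal C\oplus\mathcal C_{\rm contr}\to\mathcal C$ be the projection onto $\mathcal C$ along $\mathcal C_{\rm contr}$ (both defined in the context), and $\operatorname{in}:\mathcal C\to\mathcal C(D)$ the inclusion. Define an $R$-linear map $h_1:\mathcal C(D)\to\mathcal C(D)$ on generators by $$h_1\bigl(N(p)\otimes[xa]\bigr)=P(p,-)\otimes[x],\qquad h_1\bigl(P(p,q)\otimes[x]\bigr)=0 .$$ Then $$\delta_{s,t}\circ h_1+h_1\circ\delta_{s,t}=\operatorname{id}-\operatorname{in}\circ\rho_1 ,$$ i.e. $h_1$ is a chain homotopy connecting $\operatorname{in}\circ\rho_1$ to the identity.
   Context: **The complex.** Let $R=\mathbb Z[s,t]$ and let $D$ be an oriented link diagram. At each crossing a marker is chosen: the positive marker is the $A$-smoothing and the negative marker is the $A^{-1}$-smoothing of the Kauffman bracket $\langle D_\times\rangle=A\langle D_0\rangle+A^{-1}\langle D_\infty\rangle$. An enhanced state $S$ is a choice of a marker at each crossing together with a sign $+$ or $-$ on each circle of the smoothed diagram (state circle). An oriented enhanced state is $S\otimes[x]$ where $x$ is a sequence listing each negative-marker crossing of $S$ exactly once; if $x'$ is a permutation of $x$ then $S\otimes[x']=\pm S\otimes[x]$, with sign the sign of the permutation. $\mathcal C(D)=\bigoplus_i\mathcal C^i(D)$ is the free $R$-module generated by oriented enhanced states modulo these relations; $\mathcal C^i(D)$ is spanned by states with $i(S)=(w(D)-\sigma(S))/2=i$,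 where $w(D)$ is the writhe and $\sigma(S)$ is the number of positive markers minus the number of negative markers. Let $V$ be the free $R$-module on the signs $+,-$, with commutative bilinear product $m(+:+)=s\,(+)+t\,(-)$, $m(+:-)=m(-:+)=+$, $m(-:-)=-$, and coproduct $\Delta(+)=(+)\otimes(+)+t\,(-)\otimes(-)$, $\Delta(-)=(+)\otimes(-)+(-)\otimes(+)-s\,(-)\otimes(-)$. The map $\delta_{s,t}:\mathcal C^i(D)\to\mathcal C^{i+1}(D)$ is $\delta_{s,t}(S\otimes[x])=\sum_a S_a\otimes[xa]$, the sum over crossings $a$ with positive marker in $S$, where $S_a$ is the combination of enhanced states obtained by making the marker at $a$ negative: if two circles with signs $p,q$ merge, the new circle is labelled $m(p:q)$; if a circle with sign $p$ splits, the two new circles are labelled by $\Delta(p)$; other signs are unchanged. Labels are extended $R$-linearly. It is known that $\delta_{s,t}^2=0$. **The kink.** Inside a small disk $D$ is a kink: a single strand with one self-crossing $a$, such that smoothing $a$ with the positive marker gives an arc together with a small circle contained in the disk, and smoothing $a$ with the negative marker gives just an arc. $P(p,q)\otimes[x]$ denotes an enhanced state with positive marker at $a$, sign $p$ on the circle containing the arc and sign $q$ on the small circle; $N(p)\otimes[xa]$ denotes one with negative marker at $a$ and sign $p$ on the circle containing the arc. Here $x$ lists the negative-marker crossings outside the disk; markers outside the disk and signs of circles not meeting the disk are arbitrary and are the same on both sides of every formula. $\mathcal C\subset\mathcal C(D)$ is the submodule generated by all $P(p,+)\otimes[x]-P(m(p:+),-)\otimes[x]$ ($p=\pm$), and $\mathcal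 C_{\rm contr}$ is the submodule generated by all $P(p,-)\otimes[x]$ and $N(p)\otimes[xa]$ ($p=\pm$). One has $\mathcal C(D)=\mathcal C\oplus\mathcal C_{\rm contr}$ as complexes. *)

(* Defs.v *)
(* MathComp; mathcomp.classical is used only for classical choice. *)
From HB Require Import structures.
From mathcomp Require Import all_boot all_order all_fingroup all_algebra.
From mathcomp Require Import mpoly.
From mathcomp Require Import boolp classical_sets.

Set Implicit Arguments.
Unset Strict Implicit.
Unset Printing Implicit Defensive.

Import GRing.Theory.
Local Open Scope ring_scope.

Section Span.
Variables (R : nzRingType) (V : lmodType R) (G : V -> Prop).

Definition span : {pred V} := fun u =>
  `[< exists (n : nat) (c : 'I_n -> R) (g : 'I_n -> V),
        (forall i, G (g i)) /\ u = \sum_(i < n) c i *: g i >].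

Lemma span_submod : submod_closed span.
Proof.
split=> [|k u v /asboolP[n [c [g [Gg ->]]]] /asboolP[m [d [f [Gf ->]]]]].
  apply/asboolP; exists 0%N, (fun=> 0), (fun=> 0).
  by rewrite big_ord0; split=> // -[].
apply/asboolP; exists (n + m)%N.
exists (fun i => match split i with inl j => k * c j | inr j => d j end).
exists (fun i => match split i with inl j => g j | inr j => f j end).
split=> [i|]; first by case: (split i).
rewrite big_split_ord scaler_sumr; congr (_ + _); apply: eq_bigr => i _.
  by rewrite (unsplitK (inl _ i)) scalerA.
by rewrite (unsplitK (inr _ i)).
Qed.

HB.instance Definition _ := GRing.isSubmodClosed.Build R V span span_submod.

Lemma mem_span u : G u -> u \in span.
Proof.
move=> Gu; apply/asboolP; exists 1%N, (fun=> 1), (fun=> u).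
by rewrite big_ord1 scale1r.
Qed.

End Span.

Section QuotientModule.
Variables (R : nzRingType) (V : lmodType R) (G : V -> Prop).
Local Notation I := (span G).

Definition quotmod : Type := Quotient.quot I.
HB.instance Definition _ := GRing.Zmodule.on quotmod.

Definition qproj (v : V) : quotmod := (\pi_(Quotient.quot I) v)%qT.
Definition qrepr (u : quotmod) : V := generic_quotient.repr (u : Quotient.quot I).

Lemma qreprK u : qproj (qrepr u) = u.
Proof. exact: reprK. Qed.

Lemma qprojD v w : qproj (v + w) = qproj v + qproj w.
Proof. exact: Quotient.pi_add. Qed.

Lemma qproj_eq v w : (qproj v == qproj w) = (v - w \in I).
Proof. by rewrite Quotient.idealrBE. Qed.

Definition qscale (k : R) (u : quotmod) : quotmod := qproj (k *: qrepr u).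

Lemma qprojZ k v : qproj (k *: v) = qscale k (qproj v).
Proof.
apply/eqP; rewrite qproj_eq -scalerBr; apply: rpredZ.
by rewrite -qproj_eq qreprK.
Qed.

Fact qscaleA a b u : qscale a (qscale b u) = qscale (a * b) u.
Proof. by rewrite -[u]qreprK -!qprojZ scalerA. Qed.
Fact qscale1 : left_id 1 qscale.
Proof. by move=> u; rewrite -[u]qreprK -qprojZ scale1r. Qed.
Fact qscaleDr : right_distributive qscale +%R.
Proof.
by move=> a u v; rewrite -[u]qreprK -[v]qreprK -qprojD -!qprojZ -qprojD scalerDr.
Qed.
Fact qscaleDl v : {morph qscale^~ v : a b / a + b}.
Proof. by move=> a b; rewrite -[v]qreprK -!qprojZ -qprojD scalerDl. Qed.

HB.instance Definition _ :=
  GRing.Zmodule_isLmodule.Build R quotmod qscaleA qscale1 qscaleDr qscaleDl.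

Fact qproj_linear : linear qproj.
Proof. by move=> k u v; rewrite qprojD qprojZ. Qed.
HB.instance Definition _ := GRing.isLinear.Build R V quotmod _ qproj qproj_linear.

Definition qlift (W : lmodType R) (f : V -> W) (u : quotmod) : W := f (qrepr u).

Lemma qliftE (W : lmodType R) (f : {linear V -> W}) :
  (forall v, v \in I -> f v = 0) -> forall v, qlift f (qproj v) = f v.
Proof.
move=> fI v; apply/eqP; rewrite -subr_eq0 -linearB; apply/eqP/fI.
by rewrite -qproj_eq qreprK.
Qed.

Lemma qlift_linear (W : lmodType R) (f : {linear V -> W}) :
  (forall v, v \in I -> f v = 0) -> linear (qlift f).
Proof.
move=> fI k u v; rewrite -[u]qreprK -[v]qreprK -linearP !qliftE //.
exact: linearP.
Qed.

End QuotientModule.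

(* Combinatorial planar diagrams.  [(c, 0), (c, 1), (c, 2), (c, 3)] are the four
   half-edges leaving the crossing [c], in counterclockwise order; the
   understrand consists of [(c, 0)] and [(c, 2)], the overstrand of [(c, 1)] and
   [(c, 3)].  [glue] matches the two halves of every edge.  [loop] indexes the
   components without crossings; their orientations play no role and are not
   recorded.  [out d] means that the strand is directed away from the crossing
   at [d].  [planar] is Euler's formula, with #|crossing| vertices and
   2 #|crossing| edges: every connected component of the underlying 4-valent map
   has genus 0. *)

Definition next_dart (X : finType) (d : X * 'Z_4) : X * 'Z_4 := (d.1, d.2 + 1).

Record diagram := Diagram {
  crossing : finType;
  loop : finType;
  glue : crossing * 'Z_4 -> crossing * 'Z_4;
  out : crossing * 'Z_4 -> bool;
  glueK : involutive glue;
  glue_neq : forall d, glue d != d;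
  out_glue : forall d, out (glue d) = ~~ out d;
  out_opp : forall c i, out (c, i + 2) = ~~ out (c, i);
  planar :
    fcard (fun d => next_dart (glue d)) predT
    = (#|crossing|
       + 2 * n_comp [rel d e | (e == glue d) || (e == next_dart d)] predT)%N
}.

Definition dart (D : diagram) : finType := (crossing D * 'Z_4)%type.

(* For an understrand going from 0 to 2, the crossing is positive when the
   overstrand goes from 3 to 1, that is, crosses it from left to right. *)
Definition positive_crossing (D : diagram) (c : crossing D) : bool :=
  out (c, 0) != out (c, 1).

Definition writhe (D : diagram) : int :=
  \sum_(c : crossing D) (if positive_crossing c then 1 else -1).

Definition Zst := {mpoly int[2]}.
Definition var_s : Zst := 'X_(0 : 'I_2).
Definition var_t : Zst := 'X_(1 : 'I_2).

Definition plus := true.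
Definition minus := false.

(* [mul p q r] is the coefficient of [r] in m(p:q). *)
Definition mul (p q r : bool) : Zst :=
  if p && q then (if r then var_s else var_t) else (r == (p || q))%:R.

(* [comul p q r] is the coefficient of [q] (x) [r] in Delta(p). *)
Definition comul (p q r : bool) : Zst :=
  if p then (if q && r then 1 else if ~~ q && ~~ r then var_t else 0)
  else (if q (+) r then 1 else if ~~ q && ~~ r then - var_s else 0).

(* [true] is the positive marker and [false] the negative one.  The A-smoothing
   merges the two regions swept by the overstrand when it is rotated
   counterclockwise, those between 1 and 2 and between 3 and 0; hence it joins 0
   with 1 and 2 with 3.  The other smoothing joins 0 with 3 and 1 with 2. *)
Definition smooth (D : diagram) (mu : crossing D -> bool) (d : dart D) : dart D :=
  (d.1, (if mu d.1 then 1 else -1) - d.2).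

Definition point (D : diagram) : finType := (dart D + loop D)%type.

Definition adj (D : diagram) (mu : crossing D -> bool) : rel (point D) :=
  fun y z => match y, z with
    | inl d, inl e => (e == glue d) || (e == smooth mu d)
    | _, _ => false
    end.

(* The state circles are the classes of [connect (adj mu)]; a sign on each
   circle is encoded as a function on points that is constant on the classes. *)
Definition estate (D : diagram) : finType :=
  {ml : {ffun crossing D -> bool} * {ffun point D -> bool}
  | [forall y, forall z, adj ml.1 y z ==> (ml.2 y == ml.2 z)]}.

Section States.
Variable D : diagram.
Implicit Types (S T : estate D) (a c : crossing D) (x : seq (crossing D)).

Definition marker S : {ffun crossing D -> bool} := (val S).1.
Definition label S : {ffun point D -> bool} := (val S).2.

Definition same_circle S : rel (point D) := connect (adj (marker S)).

Definition at_ a (i : 'Z_4) : point D := inl (a, i).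

Definition touches S a (y : point D) : bool := [exists i, same_circle S (at_ a i) y].

(* Same markers away from [a], and same signs on the circles of [S] not passing
   through [a]; those are also circles of [T] once the markers agree. *)
Definition agree_off a S T : bool :=
  [forall c, (c != a) ==> (marker T c == marker S c)] &&
  [forall y, ~~ touches S a y ==> (label T y == label S y)].

Definition sigma S : int := \sum_c (if marker S c then 1 else -1).

(* The numerator is always even. *)
Definition ideg S : int := ((writhe D - sigma S) %/ 2)%Z.

Definition lists S x : bool := perm_eq x (enum [pred c | ~~ marker S c]).

(* The bound on the length of the sequence is implied by [lists]; it serves to
   make [ostate] a finType. *)
Definition ostate : finType :=
  {Sx : estate D * (#|crossing D|).-bseq (crossing D) | lists Sx.1 Sx.2}.

Definition free_chain : lmodType Zst := {ffun ostate -> Zst^o}.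

(* 0 if [x] does not list the negative crossings of [S]. *)
Definition free_gen S x : free_chain :=
  [ffun o : ostate => (((val o).1 == S) && (((val o).2 : seq _) == x))%:R : Zst^o]
    : {ffun ostate -> Zst^o}.

Definition permute x (w : 'S_(size x)) : seq (crossing D) :=
  [tuple tnth (in_tuple x) (w i) | i < size x].

Definition perm_relation (u : free_chain) : Prop :=
  exists S x (w : 'S_(size x)),
    lists S x /\ u = free_gen S (permute w) - (-1) ^+ odd_perm w *: free_gen S x.

Definition chain : lmodType Zst := quotmod perm_relation.

(* S (x) [x] *)
Definition gen S x : chain := qproj _ (free_gen S x).

Definition chain_deg (i : int) : {pred chain} :=
  span (fun u => exists S x, [/\ lists S x, ideg S = i & u = gen S x]).

(* The coefficient of [T] in S_a, for [a] a positive-marker crossing of [S]. *)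
Definition surgery S a T : Zst :=
  if ~~ marker T a && agree_off a S T then
    if same_circle S (at_ a 0) (at_ a 2)
    then comul (label S (at_ a 0)) (label T (at_ a 0)) (label T (at_ a 2))
    else mul (label S (at_ a 0)) (label S (at_ a 2)) (label T (at_ a 0))
  else 0.

Definition delta_gen S x : chain :=
  \sum_(a | marker S a) \sum_T surgery S a T *: gen T (rcons x a).

Definition extend (W : lmodType Zst) (f : estate D -> seq (crossing D) -> W)
    (u : free_chain) : W :=
  \sum_o (u : {ffun ostate -> Zst^o}) o *: f (val o).1 (val o).2.

Definition delta : chain -> chain := qlift (extend delta_gen).


Lemma extend_linear (W : lmodType Zst) f : linear (@extend W f).
Proof.
move=> k u v; rewrite scaler_sumr -big_split; apply: eq_bigr => o _.
by rewrite !ffunE scalerDl scalerA.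
Qed.
HB.instance Definition _ (W : lmodType Zst) f :=
  GRing.isLinear.Build Zst free_chain W _ (@extend W f) (@extend_linear W f).

Lemma extend_gen (W : lmodType Zst) f S x :
  lists S x -> @extend W f (free_gen S x) = f S x.
Proof.
move=> Sx.
have xX : (size x <= #|crossing D|)%N.
  by rewrite (perm_size Sx) -cardE max_card.
pose o : ostate := Sub (S, Bseq xX) Sx.
rewrite /extend (bigD1 o) //= big1 ?addr0 => [|p po]; rewrite ffunE.
  by rewrite !eqxx scale1r.
case: eqP => [pS|]; last by rewrite scale0r.
case: eqP => [px|]; last by rewrite scale0r.
case/eqP: po; apply: val_inj; case: (val p) pS px => [S' x'] /= -> px.
by congr (_, _); apply: val_inj.
Qed.

Lemma free_gen0 S x : ~~ lists S x -> free_gen S x = 0.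
Proof.
move=> NSx; apply/ffunP=> o; rewrite !ffunE; case: eqP => //= oS.
by case: eqP => // ox; move: (valP o); rewrite /= oS ox (negPf NSx).
Qed.

Lemma gen0 S x : ~~ lists S x -> gen S x = 0.
Proof. by move=> NSx; rewrite /gen free_gen0 // linear0. Qed.

Lemma perm_permute x (w : 'S_(size x)) : perm_eq (permute w) x.
Proof. by apply/(tuple_permP (t := in_tuple x)); exists w. Qed.

Lemma lists_permute S x (w : 'S_(size x)) : lists S (permute w) = lists S x.
Proof. by rewrite /lists (permPl (perm_permute w)). Qed.

Lemma gen_permute S x (w : 'S_(size x)) :
  gen S (permute w) = (-1) ^+ odd_perm w *: gen S x.
Proof.
have [Sx|NSx] := boolP (lists S x); last first.
  by rewrite !gen0 ?scaler0 // lists_permute.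
apply/eqP; rewrite /gen -linearZ qproj_eq; apply: mem_span.
by exists S, x, w.
Qed.

Lemma span_extend (W : lmodType Zst) f :
  (forall S x (w : 'S_(size x)), lists S x ->
     f S (permute w) = (-1) ^+ odd_perm w *: f S x) ->
  forall u, u \in span perm_relation -> @extend W f u = 0.
Proof.
move=> fE u /asboolP[n [c [g [Gg ->]]]]; rewrite linear_sum big1 // => i _.
rewrite linearZ; have [S [x [w [Sx ->]]]] := Gg i.
by rewrite linearB linearZ /= !extend_gen ?lists_permute // fE // subrr scaler0.
Qed.

Lemma gen_permute_tuple S n (x : n.-tuple (crossing D)) (w : 'S_n) :
  gen S [tuple tnth x (w i) | i < n] = (-1) ^+ odd_perm w *: gen S x.
Proof.
case: x w => x xn w /=; have En := eqP xn; move: xn w.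
case: n / En => xn w.
rewrite -gen_permute; congr gen; apply: eq_map => i.
exact: set_nth_default.
Qed.

Lemma gen_permute_rcons S x (w : 'S_(size x)) a :
  gen S (rcons (permute w) a) = (-1) ^+ odd_perm w *: gen S (rcons x a).
Proof.
pose y := [tuple of rcons (in_tuple x) a].
have -> : odd_perm w = lift_perm ord_max ord_max w.
  by rewrite odd_lift_perm addbb addFb.
rewrite -(gen_permute_tuple S y); congr gen.
rewrite [RHS]/= enum_ordSr map_rcons lift_perm_id -map_comp.
have bE (i : 'I_(size x)) : bump (size x) i = i.
  by rewrite /bump leqNgt ltn_ord.
have lm (i : 'I_(size x)) : widen_ord (leqnSn _) i = lift ord_max i.
  by apply: val_inj; rewrite /= bE.
congr rcons; last by rewrite (tnth_nth a) /= nth_rcons ltnn eqxx.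
rewrite /permute /=; apply: eq_map => i /=.
rewrite lm lift_perm_lift !(tnth_nth a) /= nth_rcons.
by rewrite bE ltn_ord.
Qed.

Lemma delta_gen_permute S x (w : 'S_(size x)) :
  delta_gen S (permute w) = (-1) ^+ odd_perm w *: delta_gen S x.
Proof.
rewrite scaler_sumr; apply: eq_bigr => a _.
rewrite scaler_sumr; apply: eq_bigr => T _.
by rewrite gen_permute_rcons !scalerA mulrC.
Qed.

Lemma extend_lift (W : lmodType Zst) (f : estate D -> seq (crossing D) -> W) :
  (forall S x (w : 'S_(size x)), lists S x ->
     f S (permute w) = (-1) ^+ odd_perm w *: f S x) ->
  linear (qlift (extend f) : chain -> W) /\
  (forall S x, lists S x -> qlift (extend f) (gen S x) = f S x).
Proof.
move=> /span_extend f0; split=> [|S x Sx]; first exact: qlift_linear f0.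
by rewrite /gen (qliftE f0) /= extend_gen.
Qed.

Lemma delta_linear : linear delta.
Proof. by apply: (extend_lift _).1 => S x w _; apply: delta_gen_permute. Qed.
HB.instance Definition _ := GRing.isLinear.Build Zst chain chain _ delta delta_linear.

Lemma deltaE S x : lists S x -> delta (gen S x) = delta_gen S x.
Proof. by apply: (extend_lift _).2 => ? ? w _; apply: delta_gen_permute. Qed.

End States.

(* The half-edges [kside] and [1 - kside] at [kcrossing] form a loop without
   further crossings.  The positive smoothing joins them, which gives the small
   circle, and joins the other two, [kside + 2] and [3 - kside], into the arc; the
   negative smoothing joins each of the former with one of the latter. *)
Record kink (D : diagram) := Kink {
  kcrossing : crossing D;
  kside : 'Z_4;
  kglue : glue (kcrossing, kside) = (kcrossing, 1 - kside)
}.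

Section KinkComplex.
Variables (D : diagram) (K : kink D).
Implicit Types (S T : estate D) (x : seq (crossing D)) (p q : bool).
Local Notation a := (kcrossing K).

Definition small_point : point D := at_ a (kside K).
Definition arc_point : point D := at_ a (kside K + 2).

Definition is_P S p q : bool :=
  [&& marker S a, label S arc_point == p & label S small_point == q].

Definition is_N S p : bool := ~~ marker S a && (label S arc_point == p).

(* In the first formula [S] and [T] are the states N(p) and P(p,-) with the same
   markers and signs outside the disk. *)
Definition is_h1 (h : chain D -> chain D) : Prop :=
  (forall S T p x, is_N S p -> is_P T p minus -> agree_off a S T -> lists T x ->
     h (gen S (rcons x a)) = gen T x) /\
  (forall S p q x, is_P S p q -> lists S x -> h (gen S x) = 0).

(* [S] is P(p,+), and [T r] is P(r,-) with the same data outside the disk. *)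
Definition sub_gen (u : chain D) : Prop :=
  exists S p (T : bool -> estate D) x,
    [/\ is_P S p plus,
        forall r, is_P (T r) r minus && agree_off a S (T r),
        lists S x &
        u = gen S x - \sum_(r : bool) mul p plus r *: gen (T r) x].

Definition subC : {pred chain D} := span sub_gen.

Definition contr_gen (u : chain D) : Prop :=
  (exists S p x, [/\ is_P S p minus, lists S x & u = gen S x]) \/
  (exists S p x, [/\ is_N S p, lists S (rcons x a) & u = gen S (rcons x a)]).

Definition contrC : {pred chain D} := span contr_gen.

Definition incl (v : {v : chain D | v \in subC}) : chain D := val v.

(* The projection onto [subC] along [contrC]: the decomposition of [u] exists and
   is unique, so the default value 0 is never used. *)
Definition rho1 (u : chain D) : {v : chain D | v \in subC} :=
  xget (exist _ 0 (rpred0 (span sub_gen))) [set v | u - incl v \in contrC]%classic.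

Lemma sign_rem (R : nzRingType) n i j (e : bool) :
  (i <= n)%N -> (j <= n)%N ->
  (-1 : R) ^+ (n - i) * (-1) ^+ e
  = (-1) ^+ (odd i (+) odd j (+) e) * (-1) ^+ (n - j).
Proof.
move=> li lj; rewrite -(signr_odd R (n - i)) -(signr_odd R (n - j)) !oddB //.
rewrite -!signr_addb; congr (_ ^+ (nat_of_bool _)).
by case: (odd n) (odd i) (odd j) e => [] [] [] [].
Qed.

Lemma gen_permute_rem T n (x : n.+1.-tuple (crossing D)) (w : 'S_n.+1) b :
  uniq x -> b \in x ->
  let y := [tuple tnth x (w i) | i < n.+1] in
  (-1) ^+ (n - index b y) *: gen T (rem b y)
  = (-1) ^+ odd_perm w *: ((-1) ^+ (n - index b x) *: gen T (rem b x)).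
Proof.
move=> xU bx y.
have rem_tnth (z : n.+1.-tuple (crossing D)) (i : 'I_n.+1) :
    uniq z -> tnth z i = b -> index b z = i /\
    rem b z = [tuple tnth z (lift i k) | k < n].
  move=> zU zi.
  have iE : index b z = i by rewrite -zi (tnth_nth b) index_uniq // size_tuple.
  split=> //; rewrite remE iE.
  apply: (@eq_from_nth _ b).
    rewrite size_cat size_take size_drop !size_tuple ltn_ord subSS.
    by rewrite subnKC // -ltnS.
  rewrite size_cat size_take size_drop !size_tuple ltn_ord subSS.
  rewrite subnKC -1?ltnS // => k kn.
  rewrite -[k in RHS]/(nat_of_ord (Ordinal kn)) -tnth_nth tnth_mktuple.
  rewrite (tnth_nth b) /= nth_cat size_take size_tuple ltn_ord /bump.
  case: ltnP => ki; first by rewrite nth_take // leqNgt ki.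
  by rewrite nth_drop addSn subnKC // ki add1n.
have [j _ jb] : exists2 j, true & tnth x j = b.
  by have /tnthP[j ->] := bx; exists j.
pose i := (w^-1)%g j.
have wi : w i = j by rewrite /i permKV.
have inj_w' : injective (fun k : 'I_n => odflt k (unlift j (w (lift i k)))).
  move=> k l.
  have nj m : j != w (lift i m).
    by rewrite -wi (inj_eq perm_inj) neq_lift.
  have [k' k'E ->] := unlift_some (nj k).
  have [l' l'E ->] := unlift_some (nj l).
  by move=> /= kl; apply: (@lift_inj _ i); apply: (@perm_inj _ w); rewrite k'E l'E kl.
pose w' := perm inj_w'.
have wE : w = lift_perm i j w'.
  apply/permP => k; case: (unliftP i k) => [l ->|->]; last by rewrite lift_perm_id.
  rewrite lift_perm_lift permE.
  have nj : j != w (lift i l) by rewrite -wi (inj_eq perm_inj) neq_lift.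
  by have [l' l'E ->] := unlift_some nj.
have yU : uniq y.
  have : perm_eq y x by apply/tuple_permP; exists w.
  by move/perm_uniq ->.
have yi : tnth y i = b by rewrite tnth_mktuple wi.
have [-> ->] := rem_tnth x j xU jb; have [-> ->] := rem_tnth y i yU yi.
have -> : [tuple tnth y (lift i k) | k < n]
        = [tuple tnth [tuple tnth x (lift j k) | k < n] (w' k) | k < n].
  by apply: eq_from_tnth => k; rewrite !tnth_mktuple wE lift_perm_lift.
rewrite gen_permute_tuple !scalerA; congr (_ *: _).
rewrite wE odd_lift_perm; apply: sign_rem; by rewrite -ltnS.
Qed.

Definition h1_gen S x : chain D :=
  if marker S a then 0 else
    (-1) ^+ ((size x).-1 - index a x) *:
      \sum_(T | is_P T (label S arc_point) minus && agree_off a S T) gen T (rem a x).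

Lemma h1_gen_permute S x (w : 'S_(size x)) :
  lists S x -> h1_gen S (permute w) = (-1) ^+ odd_perm w *: h1_gen S x.
Proof.
move=> Sx; rewrite /h1_gen; have [_|Sa] := boolP (marker S a); first by rewrite scaler0.
have xU : uniq x by rewrite (perm_uniq Sx) enum_uniq.
have ax : a \in x by rewrite (perm_mem Sx) mem_enum.
rewrite size_tuple scalerA !scaler_sumr; apply: eq_bigr => T _.
rewrite -scalerA.
suff H n (z : n.-tuple (crossing D)) (v : 'S_n) : uniq z -> a \in z ->
    let y := [tuple tnth z (v i) | i < n] in
    (-1) ^+ (n.-1 - index a y) *: gen T (rem a y)
    = (-1) ^+ odd_perm v *: ((-1) ^+ (n.-1 - index a z) *: gen T (rem a z)).
  exact: (H _ (in_tuple x) w xU ax).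
case: n z v => [|n] z v zU az; last exact: (gen_permute_rem T v zU az).
by exfalso; move: az; rewrite tuple0.
Qed.

Lemma points_at i : [\/ i = kside K, i = 1 - kside K, i = kside K + 2 | i = 1 - kside K + 2].
Proof.
case: (kside K) i => [[|[|[|[|//]]]] ?] [[|[|[|[|//]]]] ?];
  by [ constructor 1; apply/val_inj | constructor 2; apply/val_inj
     | constructor 3; apply/val_inj | constructor 4; apply/val_inj ].
Qed.

Lemma related_uniq S T T' p :
  is_P T p minus -> agree_off a S T -> is_P T' p minus -> agree_off a S T' -> T = T'.
Proof.
case/and3P=> Ta /eqP Tp /eqP Tm /andP[/forallP TS /forallP TS'].
case/and3P=> T'a /eqP T'p /eqP T'm /andP[/forallP T'S /forallP T'S'].
have mE : marker T = marker T'.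
  apply/ffunP=> c; have [->|ca] := eqVneq c a; first by rewrite Ta T'a.
  by rewrite (eqP (implyP (TS c) ca)) (eqP (implyP (T'S c) ca)).
have labE U y z : same_circle U y z -> label U y = label U z.
  case/connectP=> r; elim: r y => [|y' r IH] y /=; first by move=> _ ->.
  case/andP=> yy' pr ez; rewrite -(IH _ pr ez).
  by have /forallP/(_ y)/forallP/(_ y')/implyP/(_ yy')/eqP := valP U.
have adjx U i : marker U a -> adj (marker U) (at_ a i) (at_ a (1 - i)).
  by move=> Ua; rewrite /= /smooth /= Ua eqxx orbT.
have lab_at i : label T (at_ a i) = label T' (at_ a i).
  have e1 U : marker U a -> label U (at_ a (1 - kside K)) = label U small_point.
    by move=> Ua; apply/esym/labE/connect1/adjx.
  have e2 U : marker U a -> label U (at_ a (1 - kside K + 2)) = label U arc_point.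
    move=> Ua; apply/esym/labE/connect1.
    have -> : 1 - kside K + 2 = 1 - (kside K + 2).
      by case: (kside K) => [[|[|[|[|//]]]] ?]; apply/val_inj.
    exact: adjx.
  case: (points_at i) => ->.
  - by rewrite -/small_point Tm T'm.
  - by rewrite !e1 // Tm T'm.
  - by rewrite -/arc_point Tp T'p.
  - by rewrite !e2 // Tp T'p.
have lE : label T = label T'.
  apply/ffunP=> y; have [/existsP[i ay]|] := boolP (touches S a y); last first.
    move=> nt; rewrite (eqP (implyP (TS' y) nt)) (eqP (implyP (T'S' y) nt)).
    by [].
  case/connectP: ay => r; elim/last_ind: r y => [|r y' IH] y /=.
    by move=> _ ->.
  rewrite rcons_path last_rcons => /andP[pr ad] ->.
  have {IH pr} := IH _ pr erefl.
  case: (last _ _) ad => [d|l] //; case: y' => [e|l] //= ad IH.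
  have [ea|ea] := eqVneq e.1 a; first by case: e ea {ad} => c j /= ->; apply: lab_at.
  have step U : agree_off a S U -> same_circle U (inl d) (inl e).
    case/andP=> /forallP US _; apply: connect1 => /=.
    case/orP: ad => [->//|/eqP ed]; rewrite ed /smooth /=.
    have dc : d.1 != a by move: ea; rewrite ed.
    by rewrite (eqP (implyP (US d.1) dc)) eqxx orbT.
  have /labE <- : same_circle T (inl d) (inl e).
    by apply: step; apply/andP; split; apply/forallP.
  have /labE <- // : same_circle T' (inl d) (inl e).
  by apply: step; apply/andP; split; apply/forallP.
apply: val_inj; rewrite [LHS]surjective_pairing [RHS]surjective_pairing.
by rewrite -/(marker T) -/(label T) mE lE.
Qed.

Lemma h1_exists : exists h : {linear chain D -> chain D}, is_h1 h.
Proof.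
have [hlin hE] := extend_lift h1_gen_permute.
pose hM := GRing.isLinear.Build _ _ _ _ _ hlin.
pose h : {linear chain D -> chain D} := HB.pack (qlift (extend h1_gen)) hM.
exists h; split=> [S T p x|S p q x]; rewrite -[GRing.Linear.sort h]/(qlift (extend h1_gen)).
  case/andP=> Sa /eqP Sp TP ST Tx.
  have ax : a \notin x.
    rewrite (perm_mem Tx) mem_enum; case/and3P: TP => Ta _ _.
    by rewrite inE /= Ta.
  have Sx : lists S (rcons x a).
    have xU : uniq x by rewrite (perm_uniq Tx) enum_uniq.
    apply: uniq_perm; rewrite ?enum_uniq ?rcons_uniq ?ax // => c.
    rewrite mem_rcons in_cons (perm_mem Tx) !mem_enum !inE.
    have [->|ca] := eqVneq c a; first by rewrite /= Sa.
    by case/andP: ST => /forallP/(_ c); rewrite ca /= => /eqP ->.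
  rewrite hE // /h1_gen (negPf Sa) size_rcons /= -cats1 index_cat (negPf ax) /= eqxx.
  rewrite addn0 subnn expr0 scale1r.
  have -> : rem a (x ++ [:: a]) = x.
    rewrite remE index_cat (negPf ax) /= eqxx addn0 take_size_cat //.
    by rewrite drop_oversize ?cats0 // size_cat addn1.
  rewrite (bigD1 T) /= ?Sp ?TP // big1 ?addr0 // => T' /andP[/andP[T'P ST'] /eqP[]].
  exact: (related_uniq T'P ST' TP ST).
by case/and3P=> Sa _ _ Sx; rewrite hE // /h1_gen Sa.
Qed.

End KinkComplex.

(* Main.v *)
(* Put Phi = delta h1 + h1 delta.  On P(p,q) only the surgery at the kink survives
   in Phi, whence Phi P(p,q) = P(m(p:q),-).  On N(p), the surgery at the kink of
   P(p,-) gives back N(p), since m(p:-) = p, and the terms at the other crossings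
   cancel: replacing N(p) by P(p,-) only adds a small circle, which no surgery
   outside the disk touches, and exchanging the last two negative crossings gives
   the opposite sign.  Hence Phi is the identity on C_contr and 0 on C, it maps
   C(D) to C_contr, and id - Phi maps C(D) to C: so C(D) is the direct sum, and
   id - Phi = in rho_1. *)
From HB Require Import structures.
Require Import Defs.
From mathcomp Require Import all_boot all_order all_fingroup all_algebra.
From mathcomp Require Import mpoly.
From mathcomp Require boolp classical_sets.
Import GRing.Theory.
Local Open Scope ring_scope.

(** * State circles as connected components *)

Lemma label_circle (D : diagram) (S : estate D) y z :
  same_circle S y z -> label S y = label S z.
Proof.
case/connectP=> r; elim: r y => [|y' r IH] y /=; first by move=> _ ->.
case/andP=> yy' pr ez; rewrite -(IH _ pr ez).
by have /forallP/(_ y)/forallP/(_ y')/implyP/(_ yy')/eqP := valP S.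
Qed.

Lemma adj_sym (D : diagram) (mu : crossing D -> bool) : ssrbool.symmetric (adj mu).
Proof.
have smoothK (d : dart D) : smooth mu (smooth mu d) = d.
  by case: d => c i; rewrite /smooth /= opprB addrC subrK.
move=> [d|l] [e|m] //=; congr orb.
  by apply/eqP/eqP => ->; rewrite glueK.
by apply/eqP/eqP => ->; rewrite smoothK.
Qed.

Lemma connect_adjC (D : diagram) (mu : crossing D -> bool) :
  connect_sym (adj mu).
Proof. exact/sym_connect_sym/adj_sym. Qed.

Lemma eq_adj (D : diagram) (mu nu : crossing D -> bool) : mu =1 nu -> adj mu =2 adj nu.
Proof. by move=> mn [d|l] [e|m] //=; rewrite /smooth mn. Qed.

Lemma eq_estate (D : diagram) (S T : estate D) :
  marker S =1 marker T -> label S =1 label T -> S = T.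
Proof.
move=> /ffunP mST /ffunP lST; apply: val_inj.
by rewrite [LHS]surjective_pairing [RHS]surjective_pairing; congr (_, _).
Qed.

(** * Spans and expansions in generators *)

Section SpanClosed.
Variables (R : nzRingType) (V : lmodType R) (G : V -> Prop).

Lemma span0 : 0 \in Defs.span G.
Proof. exact: rpred0. Qed.

Lemma spanD u v : u \in Defs.span G -> v \in Defs.span G -> u + v \in Defs.span G.
Proof. exact: rpredD. Qed.

Lemma spanZ c u : u \in Defs.span G -> c *: u \in Defs.span G.
Proof. exact: rpredZ. Qed.

Lemma span_sum (I : finType) (F : I -> V) :
  (forall i, F i \in Defs.span G) -> \sum_i F i \in Defs.span G.
Proof. by move=> FG; apply: rpred_sum. Qed.

End SpanClosed.

Arguments span0 {R V G}.
Arguments spanD {R V G u v}.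
Arguments spanZ {R V G} c {u}.

Lemma span_ind (R : nzRingType) (V : lmodType R) (G P : V -> Prop) :
  (forall u v, P u -> P v -> P (u + v)) ->
  (forall (c : R) u, P u -> P (c *: u)) -> P 0 ->
  (forall u, G u -> P u) -> forall u, u \in Defs.span G -> P u.
Proof.
move=> PD PZ P0 PG u /boolp.asboolP[n [c [g [Gg ->]]]].
by apply: (big_ind P) => // i _; apply/PZ/PG/Gg.
Qed.

Lemma ffun_sum_delta (R : nzRingType) (I : finType) (u : {ffun I -> R^o}) :
  u = \sum_i (u i : R) *: [ffun j => (j == i)%:R : R^o].
Proof.
apply/ffunP => j; rewrite sum_ffunE (bigD1 j) //= big1 => [|i ij].
  by rewrite !ffunE eqxx [_ *: _]mulr1 addr0.
by rewrite !ffunE eq_sym (negPf ij) scaler0.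
Qed.

Lemma free_chain_sum (D : diagram) (u : free_chain D) :
  u = \sum_(o : ostate D)
        ((u : {ffun ostate D -> Zst^o}) o : Zst) *: free_gen (val o).1 (val o).2.
Proof.
rewrite {1}[u](ffun_sum_delta Zst (ostate D)).
(* The delta function at [o] is convertible to the generator of [o]. *)
by apply: eq_bigr => o _; congr (_ *: _).
Qed.

(** * State circles near the kink *)

Section Kink.
Variables (D : diagram) (K : kink D).
Implicit Types (S T U : estate D) (y z : point D) (b p q r : bool).
Local Notation a := (kcrossing K).
Local Notation k := (kside K).
Local Notation arc := (arc_point K).

(** These two half-edges make up the whole small circle when the marker at [a] is positive; the
    predicate itself refers to no state. *)
Definition small y : bool := (y == at_ a k) || (y == at_ a (1 - k)).

Definition mark S b : crossing D -> bool :=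
  fun c => if c == a then b else marker S c.

Lemma mark_id S : mark S (marker S a) =1 marker S.
Proof. by move=> c; rewrite /mark; case: eqP => [->|]. Qed.

Lemma small_at c i : c != a -> small (at_ c i) = false.
Proof.
move=> ca; rewrite /small.
by apply/negP => /orP[] /eqP[/eqP]; rewrite (negPf ca).
Qed.

(** The half-edges are arranged in the pairs [i], [1 - i] that the positive smoothing joins. *)
Lemma at_aP i : [\/ i = k, i = 1 - k, i = k + 2 | i = 1 - (k + 2)].
Proof.
have -> : 1 - (k + 2) = 1 - k + 2.
  by rewrite opprD addrA; congr (_ + _); apply/val_inj.
exact: points_at.
Qed.

Lemma small_arc i : (i = k + 2) \/ (i = 1 - (k + 2)) -> small (at_ a i) = false.
Proof.
move=> ik; rewrite /small; apply/negP => /orP[] /eqP[ij]; move: ik; rewrite {}ij;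
  by case: k => [[|[|[|[|//]]]] ?] [] /eqP.
Qed.

Lemma small_arc_point : small arc = false.
Proof. by apply: small_arc; left. Qed.

Lemma small_small_point : small (small_point K).
Proof. by rewrite /small eqxx. Qed.

Lemma small_glue (d : dart D) : small (inl (glue d)) = small (inl d).
Proof.
suff H (e : dart D) : small (inl e) -> small (inl (glue e)).
  by apply/idP/idP => /H //; rewrite glueK.
case/orP=> /eqP[->]; rewrite /small ?kglue ?eqxx ?orbT //.
by rewrite -kglue glueK eqxx.
Qed.

Lemma connect_glue mu (d : dart D) : connect (adj mu) (inl d) (inl (glue d)).
Proof. by apply: connect1; rewrite /= eqxx. Qed.

Lemma connect_smooth mu (d : dart D) : connect (adj mu) (inl d) (inl (smooth mu d)).
Proof. by apply: connect1; rewrite /= eqxx orbT. Qed.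

(** The edge of the loop joins its two half-edges whatever the markers are. *)
Lemma connect_small mu y z : small y -> small z -> connect (adj mu) y z.
Proof.
have H : connect (adj mu) (at_ a k) (at_ a (1 - k)).
  by rewrite /at_ -kglue connect_glue.
by move=> /orP[] /eqP -> /orP[] /eqP -> //; rewrite connect_adjC.
Qed.

(** With the negative marker the strand runs through [k + 2], [1 - k], [k] and [1 - (k + 2)] in this
    order: the smoothing [j], [-1 - j] modulo 4 gives the outer two steps and the loop edge the
    middle one. *)
Lemma connect_at S i : connect (adj (mark S false)) arc (at_ a i).
Proof.
set e := connect _.
have sm j : e (at_ a j) (at_ a (-1 - j)).
  by have := connect_smooth (mark S false) (a, j); rewrite /smooth /mark /= eqxx.
have e1 : e arc (at_ a (1 - k)).
  have -> : 1 - k = - 1 - (k + 2).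
    by rewrite opprD [RHS]addrCA [LHS]addrC; congr (_ + _); apply/val_inj.
  exact: sm.
have e2 : e arc (at_ a k).
  by apply: connect_trans e1 _; apply: connect_small; rewrite /small eqxx ?orbT.
case: (at_aP i) => -> //; first exact: connect0.
apply: connect_trans e2 _.
have -> : 1 - (k + 2) = -1 - k.
  by rewrite opprD [LHS]addrCA [RHS]addrC; congr (_ + _); apply/val_inj.
exact: sm.
Qed.

(* The positive smoothing at the kink cuts off the small circle and changes no
   other state circle. *)
Lemma connect_mark S b y z :
  connect (adj (mark S b)) y z
  = (b ==> (small y == small z)) && connect (adj (mark S false)) y z.
Proof.
case: b => //=; set P := mark S true; set N := mark S false.
have PN c : c != a -> P c = N c by rewrite /P /N /mark => /negPf ->.
have cat i j : connect (adj N) (at_ a i) (at_ a j).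
  by apply: connect_trans (connect_at S j); rewrite connect_adjC connect_at.
have smP i : connect (adj P) (at_ a i) (at_ a (1 - i)).
  by have := connect_smooth P (a, i); rewrite /smooth /P /mark /= eqxx.
apply/idP/andP => [/connectP[s]|[/eqP yz]].
  elim: s y => [|y' s IH] y /=; first by move=> _ ->; rewrite eqxx connect0.
  case/andP=> ad /IH H /H[/eqP <- zN].
  suff [-> yN] : small y = small y' /\ connect (adj N) y y'.
    by rewrite eqxx (connect_trans yN).
  case: y y' ad {s IH H zN} => [d|l] [e|m] //= /orP[] /eqP ->.
    by rewrite small_glue connect_glue.
  have [da|da] := eqVneq d.1 a; last first.
    have -> : smooth P d = smooth N d by rewrite /smooth PN.
    rewrite connect_smooth; case: d da => c i /= ca.
    by rewrite -!/(at_ c _) !small_at.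
  case: d da => c i /= ->; rewrite /smooth /P /mark /= eqxx cat; split=> //.
  rewrite -!/(at_ a _).
  case: (at_aP i) => -> //; rewrite ?subKr.
  - by rewrite /small !eqxx orbT.
  - by rewrite /small !eqxx orbT.
  - by rewrite !small_arc //; [right|left].
  - by rewrite !small_arc //; [left|right].
(* [ret] collapses the loop to [arc]. It sends each step of a path for the negative marker to points
   connected for the positive one: at [a], both ends retract into the circle of [arc]. *)
pose ret u := if small u then arc else u.
suff H u v : connect (adj N) u v -> connect (adj P) (ret u) (ret v).
  move/H; rewrite /ret -yz; case: ifP => // ys _.
  by apply: connect_small; rewrite -?yz.
have retat i : connect (adj P) arc (ret (at_ a i)).
  rewrite /ret; case: ifP => // si; case: (at_aP i) si => ->.
  - by rewrite /small eqxx.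
  - by rewrite /small eqxx orbT.
  - by [].
  - by rewrite smP.
case/connectP=> s; elim: s u => [|u' s IH] u /=; first by move=> _ ->.
case/andP=> ad /IH H /H; apply: connect_trans.
case: u u' ad {s IH H} => [d|l] [e|m] //= /orP[] /eqP ->.
  by rewrite /ret small_glue; case: ifP => // _; apply: connect_glue.
have [da|da] := eqVneq d.1 a; last first.
  have -> : smooth N d = smooth P d by rewrite /smooth PN.
  case: d da => c i /= ca.
  by rewrite /ret -!/(at_ c _) !small_at // connect_smooth.
case: d da => c i /= ->; rewrite /smooth /= -!/(at_ a _).
by apply: connect_trans (retat _); rewrite connect_adjC.
Qed.

(** For a positive marker at [a] this is the union of the arc circle and the small circle. Ignoring
    the marker at [a], it is the same set for N(p) and P(p,q). *)
Definition on_arc S : pred (point D) := connect (adj (mark S false)) arc.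

Lemma same_circleE S y z :
  same_circle S y z
  = (marker S a ==> (small y == small z)) && connect (adj (mark S false)) y z.
Proof.
by rewrite -connect_mark /same_circle (eq_connect (eq_adj _ _ _ (mark_id S))).
Qed.

Lemma small_on_arc S y : small y -> on_arc S y.
Proof.
move=> sy; apply: (connect_trans (connect_at S k)).
by rewrite connect_small // /small eqxx.
Qed.

Lemma touches_on_arc S y : touches S a y = on_arc S y.
Proof.
apply/existsP/idP => [[i]|ay].
  by rewrite same_circleE => /andP[_]; apply/connect_trans/connect_at.
(* With a positive marker, points of the small circle are reached from [k] and those of the arc
   circle from [k + 2]. *)
exists (if small y then k else k + 2); rewrite same_circleE.
rewrite (connect_trans _ ay) 1?connect_adjC ?connect_at // andbT.
apply/implyP => _; case: ifP => sy; last by rewrite small_arc //; left.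
by rewrite /small eqxx.
Qed.

Lemma label_on_arc S y : on_arc S y -> marker S a ==> ~~ small y ->
  label S y = label S arc.
Proof.
move=> ay sy; apply/esym/label_circle; rewrite same_circleE small_arc_point.
by rewrite [connect _ _ _]ay andbT; case: (marker S a) (small y) sy => [] [].
Qed.

Lemma label_small S y : small y -> marker S a -> label S y = label S (small_point K).
Proof.
move=> sy Sa; apply/label_circle/connect_small => //; exact: small_small_point.
Qed.

(** * States with prescribed data inside the disk *)

Definition fill_data S b p q : {ffun crossing D -> bool} * {ffun point D -> bool} :=
  ([ffun c => mark S b c],
   [ffun y => if b && small y then q else if on_arc S y then p else label S y]).

(** Both tests in the labelling are constant along adjacency for the new markers. Points failing
    both lie off the loop, so adjacent ones are on one circle of [S]. *)
Lemma fill_subproof S b p q :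
  [forall y, forall z, adj (fill_data S b p q).1 y z ==>
     ((fill_data S b p q).2 y == (fill_data S b p q).2 z)].
Proof.
apply/forallP=> y; apply/forallP=> z; apply/implyP => /= ad.
have : connect (adj (mark S b)) y z.
  by apply: connect1; rewrite -(eq_adj _ _ _ (ffunE (mark S b))).
rewrite connect_mark !ffunE => /andP[bs yz].
have -> : b && small z = b && small y by case: b bs {ad} => //= /eqP ->.
have az : on_arc S z = on_arc S y.
  by apply/idP/idP => /connect_trans; apply; rewrite // connect_adjC.
rewrite az; case: ifP => // _; case: ifP => // ay.
apply/eqP/label_circle; rewrite same_circleE yz.
have ns u : on_arc S u = false -> small u = false.
  by move/negbT => nu; apply: contraNF nu; apply: small_on_arc.
by rewrite !ns ?az // implybT.
Qed.

(* The marker at the kink becomes [b] and the circles through the kink get the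
   sign [p], except for the small circle, present when [b] is positive, which
   gets [q]. *)
Definition fill S b p q : estate D :=
  exist _ (fill_data S b p q) (fill_subproof S b p q).

Lemma marker_fill S b p q c : marker (fill S b p q) c = mark S b c.
Proof. exact: ffunE. Qed.

Lemma label_fill S b p q y : label (fill S b p q) y =
  if b && small y then q else if on_arc S y then p else label S y.
Proof. exact: ffunE. Qed.

(** Stated with [on_arc], which does not see the marker at [a], the relation becomes symmetric in
    the two states; this gives symmetry and transitivity below. *)
Lemma agree_offP S T :
  reflect ((forall c, c != a -> marker T c = marker S c) /\
           (forall y, ~~ on_arc S y -> label T y = label S y))
          (agree_off a S T).
Proof.
apply: (iffP andP) => [[/forallP mST /forallP lST]|[mST lST]].
  split=> [c ca|y ny]; first exact/eqP/(implyP (mST c)).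
  by apply/eqP/(implyP (lST y)); rewrite touches_on_arc.
split; apply/forallP=> y; apply/implyP; first by move=> ya; rewrite mST.
by rewrite touches_on_arc => ny; rewrite lST.
Qed.

Lemma agree_off_on_arc S T : (forall c, c != a -> marker T c = marker S c) ->
  on_arc T =1 on_arc S.
Proof.
move=> mST y; apply: eq_connect; apply: eq_adj => c; rewrite /mark.
by case: eqVneq => // ca; rewrite mST.
Qed.

Lemma agree_off_sym S T : agree_off a S T -> agree_off a T S.
Proof.
case/agree_offP=> mST lST; apply/agree_offP; split=> [c ca|y].
  by rewrite mST.
by rewrite (agree_off_on_arc _ _ mST) => /lST.
Qed.

Lemma agree_off_trans S T U : agree_off a S T -> agree_off a T U -> agree_off a S U.
Proof.
case/agree_offP=> mST lST /agree_offP[mTU lTU]; apply/agree_offP; split=> [c ca|y ny].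
  by rewrite mTU ?mST.
by rewrite lTU ?lST // (agree_off_on_arc _ _ mST).
Qed.

Lemma agree_off_fill S b p q : agree_off a S (fill S b p q).
Proof.
apply/agree_offP; split=> [c ca|y ny]; first by rewrite marker_fill /mark (negPf ca).
rewrite label_fill (negPf ny); case: ifP => // /andP[_ /small_on_arc sy].
by rewrite sy in ny.
Qed.

Lemma marker_fill_kink S b p q : marker (fill S b p q) a = b.
Proof. by rewrite marker_fill /mark eqxx. Qed.

Lemma label_fill_arc S b p q : label (fill S b p q) arc = p.
Proof. by rewrite label_fill small_arc_point andbF /on_arc connect0. Qed.

Lemma label_fill_small S p q : label (fill S true p q) (small_point K) = q.
Proof. by rewrite label_fill small_small_point. Qed.

Lemma fillP S p q : is_P K (fill S true p q) p q.
Proof.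
by rewrite /is_P marker_fill_kink label_fill_arc label_fill_small !eqxx.
Qed.

(** Only the circles of the arc and of the loop pass through the kink, so their signs and the marker
    at [a] complete the outside data. For a negative marker the last argument of [fill] is
    ignored. *)
Lemma agree_off_fillE S T : agree_off a S T ->
  T = fill S (marker T a) (label T arc) (label T (small_point K)).
Proof.
case/agree_offP=> mST lST; apply: eq_estate => [c|y].
  by rewrite marker_fill /mark; case: eqVneq => [->|/mST].
have aTS := agree_off_on_arc _ _ mST.
rewrite label_fill; case: ifP => [/andP[Ta sy]|ns]; first exact: label_small.
case: ifP => [ay|/negbT /lST //].
by apply: label_on_arc; rewrite ?aTS //; case: (marker T a) (small y) ns => [] [].
Qed.

(* [N(p) |-> P(p,-)] *)
Definition cap S : estate D := fill S true (label S arc) minus.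

Lemma cap_eq S T : agree_off a S T -> marker T a ->
  label T arc = label S arc -> label T (small_point K) = minus -> T = cap S.
Proof. by move=> /agree_off_fillE TE Ta Tp Tm; rewrite TE Ta Tp Tm. Qed.

Lemma cap_is_P S : is_P K (cap S) (label S arc) minus.
Proof. exact: fillP. Qed.

Lemma marker_cap S c : marker (cap S) c = mark S true c.
Proof. exact: marker_fill. Qed.

Lemma label_cap S y : ~~ marker S a ->
  label (cap S) y = if small y then minus else label S y.
Proof.
move=> Sa; rewrite label_fill /=; case: ifP => // sy.
by case: ifP => // ay; rewrite (label_on_arc S y) // (negPf Sa).
Qed.

(** * Capping and surgeries away from the kink *)

Lemma same_circle_cap S y z : ~~ marker S a ->
  same_circle (cap S) y z = (small y == small z) && same_circle S y z.
Proof.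
move=> Sa; rewrite !same_circleE (negPf Sa) marker_cap /mark eqxx /=; congr andb.
apply: eq_connect; apply: eq_adj => c; rewrite marker_cap /mark.
by case: (c == a).
Qed.

Lemma touches_cap S c y : ~~ marker S a -> c != a ->
  touches (cap S) c y = ~~ small y && touches S c y.
Proof.
move=> Sa ca; rewrite /touches; apply/existsP/andP => [[i]|[sy /existsP[i iy]]].
  rewrite same_circle_cap // small_at // => /andP[/eqP <- iy]; split=> //.
  by apply/existsP; exists i.
by exists i; rewrite same_circle_cap // small_at // (negPf sy) eqxx.
Qed.

Lemma label_neg_small S y : ~~ marker S a -> small y -> label S y = label S arc.
Proof.
by move=> Sa sy; apply: label_on_arc; rewrite ?small_on_arc // (negPf Sa).
Qed.

Lemma touches_neg_small S c y : ~~ marker S a -> small y ->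
  touches S c y = touches S c arc.
Proof.
move=> Sa sy; apply: eq_existsb => i; rewrite /same_circle.
have ya : connect (adj (marker S)) y arc.
  change (same_circle S y arc).
  by rewrite same_circleE (negPf Sa) /= connect_adjC; apply: small_on_arc.
by apply/idP/idP => /connect_trans; apply; rewrite // connect_adjC.
Qed.

(** Away from the loop, capping changes neither signs nor contact with [c]. On the loop both caps
    have sign minus, while in [S] and [T] the loop carries the sign of the arc. *)
Lemma agree_off_cap S T c : ~~ marker S a -> ~~ marker T a -> c != a ->
  agree_off c (cap S) (cap T) = agree_off c S T.
Proof.
move=> Sa Ta ca; rewrite /agree_off; congr andb.
  apply: eq_forallb => e; congr (_ ==> _); rewrite !marker_cap /mark.
  by have [->|//] := eqVneq e a; rewrite (negPf Sa) (negPf Ta).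
apply/forallP/forallP => H y; apply/implyP => ny; last first.
  rewrite !label_cap //; case: ifP => // sy; apply: (implyP (H y)).
  by move: ny; rewrite touches_cap // sy.
have {}H z : ~~ small z -> ~~ touches S c z -> label T z == label S z.
  move=> sz nz; have /implyP := H z.
  by rewrite touches_cap // !label_cap // (negPf sz) /=; apply.
have [sy|/H //] := boolP (small y); last by apply.
(* The caps give no information at a loop point, so the condition is transferred to [arc], on the
   same circle of [S]. *)
rewrite !label_neg_small //; apply: H; first by rewrite small_arc_point.
by rewrite -(touches_neg_small S c y).
Qed.

Lemma surgery_cap S T c : ~~ marker S a -> ~~ marker T a -> c != a ->
  surgery (cap S) c (cap T) = surgery S c T.
Proof.
move=> Sa Ta ca; rewrite /surgery marker_cap /mark (negPf ca) agree_off_cap //.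
by rewrite same_circle_cap // !label_cap // !small_at.
Qed.

Lemma surgery_marker S T c : surgery S c T != 0 ->
  ~~ marker T c /\ forall e, e != c -> marker T e = marker S e.
Proof.
rewrite /surgery; case: ifP => [/andP[-> /andP[/forallP H _]] _|]; last by rewrite eqxx.
by split=> // e ec; apply/eqP/(implyP (H e)).
Qed.

(** The small circle passes through no crossing other than [a]. *)
Lemma surgery_small S T c : marker S a -> c != a -> surgery S c T != 0 ->
  label T (small_point K) = label S (small_point K).
Proof.
move=> Sa ca; rewrite /surgery; case: ifP => [/andP[_ /andP[_ /forallP H]] _|].
  apply/eqP/(implyP (H _)); apply/existsP => -[i].
  by rewrite same_circleE Sa small_at // small_small_point.
by rewrite eqxx.
Qed.

(** The inverse of [cap] on the states P(p,-). The argument [minus] is a placeholder, since the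
    marker becomes negative. *)
Definition uncap T : estate D := fill T false (label T arc) minus.

Lemma uncapK T : marker T a -> label T (small_point K) = minus -> cap (uncap T) = T.
Proof.
move=> Ta Tm; apply/esym/cap_eq => //; last by rewrite label_fill_arc.
exact/agree_off_sym/agree_off_fill.
Qed.

Lemma capK S : ~~ marker S a -> uncap (cap S) = S.
Proof.
move=> Sa.
have /agree_off_sym/agree_off_fillE h := agree_off_fill S true (label S arc) minus.
rewrite {2}h /uncap label_fill_arc (negPf Sa); apply: eq_estate => [c|y].
  by rewrite !marker_fill.
by rewrite !label_fill.
Qed.

(** * Orderings of crossings, degrees and generators *)

Lemma lists_cap S x : ~~ marker S a -> lists (cap S) x = lists S (rcons x a).
Proof.
move=> Sa; rewrite /lists perm_rcons -(perm_cons a).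
suff /permPr -> : perm_eq (enum [pred c | ~~ marker S c])
  (a :: enum [pred c | ~~ marker (cap S) c]) by [].
apply: uniq_perm; rewrite /= ?enum_uniq ?mem_enum //=.
  by rewrite inE marker_cap /mark eqxx.
move=> c; rewrite in_cons !mem_enum !inE marker_cap /mark.
by case: eqVneq => // ->; rewrite Sa.
Qed.

Lemma is_P_marker S : marker S a ->
  is_P K S (label S arc) (label S (small_point K)).
Proof. by move=> Sa; rewrite /is_P Sa !eqxx. Qed.

Lemma sigma_cap S : ~~ marker S a -> sigma (cap S) = sigma S + 2.
Proof.
move=> Sa; rewrite /sigma (bigD1 a) // [in RHS](bigD1 a) //= marker_cap /mark eqxx.
rewrite (negPf Sa) addrAC; congr (_ + _); apply: eq_bigr => c ca.
by rewrite marker_cap /mark (negPf ca).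
Qed.

Lemma ideg_cap S : ~~ marker S a -> ideg (cap S) = ideg S - 1.
Proof.
move=> Sa; rewrite /ideg sigma_cap //.
have -> : writhe D - (sigma S + 2) = -1 * 2 + (writhe D - sigma S).
  by rewrite opprD addrA addrC mulN1r.
by rewrite divzMDl // addrC.
Qed.

(** Used with [a] for [c], to reach the form N(p) with [a] listed last, in which [h1] is
    prescribed. *)
Lemma gen_move_last S x c : lists S x -> c \in x ->
  exists e : bool, gen S x = (-1) ^+ e *: gen S (rcons (rem c x) c) /\
                   lists S (rcons (rem c x) c).
Proof.
move=> Sx cx; set y := rcons _ _.
have xy : perm_eq x y by rewrite perm_sym perm_rcons perm_sym perm_to_rem.
have Sy : lists S y by rewrite /lists -(permPl xy).
have /(tuple_permP (t := in_tuple y))[w xw] := xy.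
exists (odd_perm w); split=> //.
by rewrite -gen_permute; congr gen.
Qed.

Lemma gen_swap_last S x (b c : crossing D) :
  gen S (rcons (rcons x b) c) = - gen S (rcons (rcons x c) b).
Proof.
pose n := size x.
pose z := [tuple of rcons (rcons (in_tuple x) c) b].
have ni : (n < n.+2)%N by apply: ltnW.
pose i := Ordinal ni; pose j : 'I_n.+2 := ord_max.
have ij : i != j by rewrite -val_eqE /= neq_ltn ltnSn.
have := gen_permute_tuple S z (tperm i j).
rewrite odd_tperm ij expr1 scaleN1r => <-; congr gen.
apply: (@eq_from_nth _ b); first by rewrite size_tuple !size_rcons.
rewrite !size_rcons => m mn.
rewrite -[m in RHS]/(nat_of_ord (Ordinal mn)) -tnth_nth tnth_mktuple.
rewrite (tnth_nth b) /= !nth_rcons !size_rcons -/n.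
case: tpermP => [/(congr1 val) /= ->|/(congr1 val) /= ->|].
- by rewrite !ltnSn !ltnn !eqxx.
- by rewrite !ltnn eqxx ltnSn eqxx.
move=> /eqP; rewrite -val_eqE /= => mi /eqP; rewrite -val_eqE /= => mj.
have -> : (m < n)%N.
  by move: mn; rewrite !ltnS leq_eqVlt (negPf mj) /= ltnS leq_eqVlt (negPf mi).
by move: mn; rewrite ltnS leq_eqVlt (negPf mj) /= => ->.
Qed.

(** Oriented states span the chains, and moving [a] to the end of the list costs only a scalar. *)
Lemma chain_gen_ind (P : chain D -> Prop) :
  (forall u v, P u -> P v -> P (u + v)) ->
  (forall (c : Zst) u, P u -> P (c *: u)) -> P 0 ->
  (forall S x, marker S a -> lists S x -> P (gen S x)) ->
  (forall S x, ~~ marker S a -> lists S (rcons x a) -> P (gen S (rcons x a))) ->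
  forall u, P u.
Proof.
move=> PD PZ P0 PP PN u.
have PG S x : lists S x -> P (gen S x).
  move=> Sx; have [/PP|Sa] := boolP (marker S a); first exact.
  have ax : a \in x by rewrite (perm_mem Sx) mem_enum inE.
  by have [e [-> Sy]] := gen_move_last _ _ _ Sx ax; apply/PZ/PN.
rewrite -[u]qreprK.
rewrite [qrepr u]free_chain_sum linear_sum; apply: (big_ind P) => // o _.
by rewrite linearZ_LR; apply/PZ/PG/(valP o).
Qed.

(** * Sums over the targets of a surgery *)

(** Exactly one of two opposite half-edges lies on the loop; hence surgery at a positive kink is
    always a merge. *)
Lemma same_circle_kink S : marker S a -> same_circle S (at_ a 0) (at_ a 2) = false.
Proof.
move=> Sa; rewrite same_circleE Sa /= /small /at_.
rewrite !(inj_eq (@inl_inj _ _)) !xpair_eqE eqxx /=.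
by case: k => [[|[|[|[|//]]]] ?].
Qed.

(** Which of the half-edges 0 and 2 lies on the loop depends on [k]; commutativity of m absorbs the
    difference. *)
Lemma mul_kink S r : marker S a ->
  Defs.mul (label S (at_ a 0)) (label S (at_ a 2)) r
  = Defs.mul (label S arc) (label S (small_point K)) r.
Proof.
move=> Sa.
have mulC p q : Defs.mul p q r = Defs.mul q p r.
  by rewrite /Defs.mul andbC orbC.
have H i : label S (at_ a i) = if small (at_ a i) then label S (small_point K)
                                 else label S arc.
  case: ifP => si; first exact: label_small.
  by apply: label_on_arc; rewrite ?si ?implybT // /on_arc connect_at.
suff : small (at_ a 0) != small (at_ a 2).
  rewrite (H 0) (H 2).
  case: (small (at_ a 0)) (small (at_ a 2)) => [] [] // _; exact: mulC.
rewrite /small /at_ !(inj_eq (@inl_inj _ _)) !xpair_eqE eqxx /=.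
by case: k => [[|[|[|[|//]]]] ?].
Qed.

Lemma surgery_kink S r : marker S a ->
  surgery S a (fill S false r r) = Defs.mul (label S arc) (label S (small_point K)) r.
Proof.
move=> Sa; rewrite /surgery marker_fill_kink agree_off_fill same_circle_kink //=.
by rewrite mul_kink // label_fill /= /on_arc connect_at.
Qed.

(** By [agree_off_fillE], a target with non-zero coefficient is determined by the sign [r] of the
    merged circle; the second [r] in [fill S false r r] is a placeholder. *)
Lemma sum_surgery_kink (W : lmodType Zst) (F : estate D -> W) S : marker S a ->
  \sum_T surgery S a T *: F T
  = \sum_(r : bool)
      Defs.mul (label S arc) (label S (small_point K)) r *: F (fill S false r r).
Proof.
move=> Sa; rewrite (partition_big (fun T => label T arc) xpredT) //=.
apply: eq_bigr => r _.
rewrite (bigD1 (fill S false r r)) /=; last by rewrite label_fill_arc.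
rewrite surgery_kink // big1 ?addr0 // => T /andP[/eqP Tr nT].
suff -> : surgery S a T = 0 by rewrite scale0r.
rewrite /surgery; case: ifP => // /andP[Ta ST]; case/eqP: nT.
rewrite (agree_off_fillE _ _ ST) Tr (negPf Ta).
by apply: eq_estate => [c|y]; rewrite ?marker_fill ?label_fill.
Qed.

Lemma cap_fill S r : cap (fill S false r r) = fill S true r minus.
Proof.
apply/esym/cap_eq; rewrite ?marker_fill_kink ?label_fill_arc ?label_fill_small //.
exact: (agree_off_trans _ _ _ (agree_off_sym _ _ (agree_off_fill _ _ _ _))
                              (agree_off_fill _ _ _ _)).
Qed.

Lemma mul_minus p r : Defs.mul p minus r = (r == p)%:R.
Proof. by rewrite /Defs.mul /minus andbF orbF. Qed.

Lemma sum_mul_minus (W : lmodType Zst) (F : bool -> W) p :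
  \sum_(r : bool) Defs.mul p minus r *: F r = F p.
Proof.
rewrite (bigD1 p) //= mul_minus eqxx scale1r big1 ?addr0 // => r /negPf rp.
by rewrite mul_minus rp scale0r.
Qed.

(** The sign minus is the unit of m, so merging the added circle back restores [S]. *)
Lemma sum_surgery_cap_kink (W : lmodType Zst) (F : estate D -> W) S :
  ~~ marker S a -> \sum_T surgery (cap S) a T *: F T = F S.
Proof.
move=> Sa; rewrite sum_surgery_kink ?marker_fill_kink //.
rewrite label_fill_small label_fill_arc sum_mul_minus; congr F.
rewrite -[RHS]capK // /uncap label_fill_arc; apply: eq_estate => [c|y].
  by rewrite !marker_fill.
by rewrite !label_fill.
Qed.

(** Targets are reindexed by [cap], with inverse [uncap]. Any target that is not a cap has
    coefficient 0, because surgery at [c] preserves the marker at [a] and the sign of the small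
    circle. *)
Lemma sum_surgery_cap (W : lmodType Zst) (F : estate D -> W) S c :
  ~~ marker S a -> c != a ->
  \sum_T surgery (cap S) c T *: F T
  = \sum_(T | ~~ marker T a) surgery S c T *: F (cap T).
Proof.
move=> Sa ca.
rewrite (bigID (fun T => marker T a && (label T (small_point K) == minus))) /=.
rewrite addrC big1 ?add0r => [|T nT].
  rewrite (reindex_onto cap uncap) /=; last by move=> T /andP[Ta /eqP]; apply: uncapK.
  apply: eq_big => [T|T /andP[_ /eqP TT]].
    rewrite marker_fill_kink label_fill_small eqxx /=.
    by apply/eqP/idP => [<-|/capK //]; rewrite marker_fill_kink.
  by rewrite surgery_cap // -TT marker_fill_kink.
have mc : marker (cap S) a by rewrite marker_fill_kink.
have [->|sT] := eqVneq (surgery (cap S) c T) 0; first by rewrite scale0r.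
case/negP: nT; have [_ ->] := surgery_marker _ _ _ sT; last by rewrite eq_sym.
by rewrite mc (surgery_small _ _ _ mc ca sT) label_fill_small eqxx.
Qed.

Lemma delta_cap S x : ~~ marker S a -> lists S (rcons x a) ->
  delta (gen (cap S) x) = gen S (rcons x a) +
    \sum_(c | marker S c)
      \sum_(T | ~~ marker T a) surgery S c T *: gen (cap T) (rcons x c).
Proof.
move=> Sa Sx; have mc : marker (cap S) a by rewrite marker_fill_kink.
rewrite deltaE; last by rewrite lists_cap.
rewrite /delta_gen [LHS](bigD1 a mc); apply: (congr2 +%R).
  exact: (sum_surgery_cap_kink _ (fun T => gen T (rcons x a)) S Sa).
apply: eq_big => [c|c /andP[_ ca]]; last first.
  exact: (sum_surgery_cap _ (fun T => gen T (rcons x c))).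
rewrite marker_cap /mark; case: eqVneq => [->|]; rewrite ?andbT //.
by rewrite (negPf Sa).
Qed.

(** * The map Phi and the two summands *)

Section Homotopy.
Variables (h : {linear chain D -> chain D}) (hP : is_h1 K h).

Lemma h1_P S x : marker S a -> h (gen S x) = 0.
Proof.
move=> Sa; have [Sx|Sx] := boolP (lists S x); last by rewrite Defs.gen0 ?linear0.
exact: (hP.2 _ _ _ _ (is_P_marker _ Sa)).
Qed.

Lemma h1_N S x : ~~ marker S a -> h (gen S (rcons x a)) = gen (cap S) x.
Proof.
move=> Sa; have [Sx|Sx] := boolP (lists S (rcons x a)); last first.
  by rewrite !Defs.gen0 ?linear0 // lists_cap.
apply: (hP.1 S (cap S) (label S arc)); rewrite ?cap_is_P ?agree_off_fill ?lists_cap //.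
by rewrite /is_N Sa eqxx.
Qed.

Definition dh (u : chain D) : chain D := delta (h u) + h (delta u).

Fact dh_linear : linear dh.
Proof.
by move=> c u v; rewrite /dh !linearP /= scalerDr addrACA.
Qed.
HB.instance Definition _ := GRing.isLinear.Build Zst (chain D) (chain D) _ dh dh_linear.

(* Restated with [dh] as head symbol, which [linearD] and the like lose. *)
Lemma dhD u v : dh (u + v) = dh u + dh v. Proof. exact: linearD. Qed.
Lemma dhB u v : dh (u - v) = dh u - dh v. Proof. exact: linearB. Qed.
Lemma dhZ c u : dh (c *: u) = c *: dh u. Proof. exact: linearZ_LR. Qed.
Lemma dh0 : dh 0 = 0. Proof. exact: linear0. Qed.
Lemma dh_sum (I : finType) (F : I -> chain D) :
  dh (\sum_i F i) = \sum_i dh (F i).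
Proof. exact: linear_sum. Qed.

Lemma dh_P S x : marker S a -> lists S x ->
  dh (gen S x) = \sum_(r : bool)
    Defs.mul (label S arc) (label S (small_point K)) r *: gen (fill S true r minus) x.
Proof.
move=> Sa Sx; rewrite /dh h1_P; last exact: Sa.
rewrite linear0 add0r deltaE; last exact: Sx.
rewrite /delta_gen linear_sum [LHS](bigD1 a Sa) [X in _ + X = _]big1.
  rewrite addr0 (sum_surgery_kink _ (fun T => gen T (rcons x a)) S Sa) linear_sum.
  apply: eq_bigr => r _; rewrite linearZ_LR h1_N; last by rewrite marker_fill_kink.
  by rewrite cap_fill.
(* After surgery at another crossing the marker at [a] is still positive, so [h] kills the term. *)
move=> c /andP[Sc ca]; rewrite linear_sum; apply: big1 => T _; rewrite linearZ_LR.
have [->|/surgery_marker[_ mT]] := eqVneq (surgery S c T) 0; first exact: scale0r.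
by rewrite h1_P ?scaler0 // mT // eq_sym.
Qed.

Lemma dh_N S x : ~~ marker S a -> lists S (rcons x a) ->
  dh (gen S (rcons x a)) = gen S (rcons x a).
Proof.
move=> Sa Sx; rewrite /dh h1_N; last exact: Sa.
rewrite (delta_cap S x Sa Sx) -addrA deltaE; last exact: Sx.
rewrite /delta_gen linear_sum -big_split big1; first exact: addr0.
move=> c Sc /=; have ca : a != c by apply: contraNneq Sa => ->.
(* Targets with a positive marker at [a] have coefficient 0; the others cancel in pairs once [a] and
   [c] are exchanged in the list. *)
rewrite linear_sum [X in _ + X](bigID (fun T => ~~ marker T a)).
rewrite [X in _ + (_ + X)]big1 => [|T /negPn Ta].
  rewrite addr0 -big_split; apply: big1 => T Ta /=.
  rewrite linearZ_LR gen_swap_last linearN h1_N; last exact: Ta.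
  by rewrite scalerN subrr.
have [->|/surgery_marker[_ mT]] := eqVneq (surgery S c T) 0.
  by rewrite scale0r linear0.
by move: Ta; rewrite mT // (negPf Sa).
Qed.

Lemma dh_contr u : u \in contrC K -> dh u = u.
Proof.
apply: (span_ind _ _ _ (fun u => dh u = u)) => [v w vE wE|c v vE||].
- by rewrite dhD vE wE.
- by rewrite dhZ vE.
- exact: dh0.
move=> v [[S [p [x [/and3P[Sa _ /eqP Sm] Sx ->]]]]|]; last first.
  by move=> [S [p [x [/andP[Sa _] Sx ->]]]]; apply: dh_N.
(* A state P(p,-) is its own cap, so m(p:-) = p leaves only the generator itself. *)
have capS : cap S = S by apply/esym/cap_eq => //; apply/agree_offP.
rewrite (dh_P S x Sa Sx) Sm (sum_mul_minus _ (fun r => gen (fill S true r minus) x)).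
by rewrite -/(cap S) capS.
Qed.

Lemma contr_P S p x : is_P K S p minus -> gen S x \in contrC K.
Proof.
move=> SP; have [Sx|Sx] := boolP (lists S x).
  by apply: mem_span; left; exists S, p, x.
by rewrite Defs.gen0 //; apply: span0.
Qed.

(** Phi sends P(p,+) to the very combination of states P(r,-) subtracted in the generator, and Phi
    fixes that combination. *)
Lemma dh_sub u : u \in subC K -> dh u = 0.
Proof.
apply: (span_ind _ _ _ (fun u => dh u = 0)) => [v w vE wE|c v vE||].
- by rewrite dhD vE wE addr0.
- by rewrite dhZ vE scaler0.
- exact: dh0.
move=> v [S [p [T [x [/and3P[Sa /eqP <- /eqP Sp] TP Sx ->]]]]].
rewrite dhB dh_sum dh_P // Sp; apply/eqP; rewrite subr_eq0; apply/eqP.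
apply: eq_bigr => r _; have /andP[TrP STr] := TP r.
rewrite dhZ (dh_contr _ (contr_P _ r x TrP)).
(* The states [T r] of a generator are given only by their properties; uniqueness identifies them
   with the filled states. *)
by rewrite (related_uniq TrP STr (fillP S r minus) (agree_off_fill S true r minus)).
Qed.

Lemma dh_mem_contr u : dh u \in contrC K.
Proof.
elim/chain_gen_ind: u => [u v uC vC|c u uC||S x Sa Sx|S x Sa Sx].
- rewrite dhD; exact: spanD uC vC.
- rewrite dhZ; exact (spanZ c uC).
- rewrite dh0; exact: span0.
- rewrite (dh_P S x Sa Sx); apply: span_sum => r; apply: spanZ.
  exact: (contr_P _ r) (fillP _ _ _).
- rewrite (dh_N S x Sa Sx); apply: mem_span; right; exists S, (label S arc), x.
  by rewrite /is_N Sa eqxx.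
Qed.

Lemma sub_dh_mem u : u - dh u \in subC K.
Proof.
elim/chain_gen_ind: u => [u v uC vC|c u uC||S x Sa Sx|S x Sa Sx].
- rewrite dhD opprD addrACA; exact: spanD uC vC.
- rewrite dhZ -scalerBr; exact (spanZ c uC).
- rewrite dh0 subr0; exact: span0.
(* For sign minus on the small circle the state is fixed by Phi and the difference is 0; for sign
   plus the difference is a generator of [subC]. *)
- have [Sp|Sm] := boolP (label S (small_point K)); last first.
    rewrite dh_contr; first by rewrite subrr; apply: span0.
    by apply: (contr_P _ (label S arc)); rewrite /is_P Sa (negPf Sm) !eqxx.
  apply: mem_span; exists S, (label S arc), (fun r => fill S true r minus), x.
  split=> [|r||]; first by rewrite /is_P Sa Sp !eqxx.
  + by rewrite fillP agree_off_fill.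
  + exact: Sx.
  by rewrite (dh_P S x Sa Sx) Sp.
- rewrite (dh_N S x Sa Sx) subrr; exact: span0.
Qed.

(** * The projection and the degree of the homotopy *)

Lemma incl_rho1 u : incl (rho1 K u) = u - dh u.
Proof.
pose v := exist (fun v => v \in subC K) (u - dh u) (sub_dh_mem u).
suff -> : rho1 K u = v by [].
apply: classical_sets.xget_unique => [|w wC].
  by change (u - (u - dh u) \in contrC K); rewrite subKr dh_mem_contr.
apply: val_inj; change (incl w = u - dh u).
(* Uniqueness: Phi fixes [u - incl w] and kills [incl w], so it sends [u] to [u - incl w]. *)
have := dh_contr _ wC; rewrite dhB (dh_sub (incl w)); last exact: (valP w).
by rewrite subr0 => ->; rewrite subKr.
Qed.

(** On a state with negative marker at [a], capping raises sigma by 2 and so lowers the degree by 1;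
    the other generators are sent to 0. *)
Lemma h1_deg i u : u \in chain_deg i -> h u \in chain_deg (i - 1).
Proof.
apply: (span_ind _ _ _ (fun u => h u \in chain_deg (i - 1)))
  => [v w vE wE|c v vE||v [S [x [Sx <- ->]]]].
- rewrite linearD; exact: spanD vE wE.
- rewrite linearZ_LR; exact (spanZ c vE).
- rewrite linear0; exact: span0.
have [Sa|Sa] := boolP (marker S a); first by rewrite h1_P //; apply: span0.
have ax : a \in x by rewrite (perm_mem Sx) mem_enum inE.
have [e [-> Sy]] := gen_move_last _ _ _ Sx ax.
rewrite linearZ_LR h1_N; last exact: Sa.
apply: (spanZ _ _); apply: mem_span; exists (cap S), (rem a x).
by rewrite lists_cap // ideg_cap.
Qed.

End Homotopy.
End Kink.

Theorem proposition4p6 (D : diagram) (K : kink D)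
    (h1 : {linear chain D -> chain D}) (h1P : is_h1 K h1) :
  (forall (i : int) (u : chain D),
     u \in chain_deg i -> h1 u \in chain_deg (i - 1)) /\
  (forall u : chain D, delta (h1 u) + h1 (delta u) = u - incl (rho1 K u)).
Proof.
split=> [i u|u]; first exact: (h1_deg D K h1 h1P).
by rewrite (incl_rho1 D K h1 h1P u) subKr.
Qed.
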